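(* For all integers $n\ge1$, $$\|\operatorname{Re} V^n\|_{\mathrm{HS}}=\|\operatorname{Im} V^n\|_{\mathrm{HS}}=\frac{1}{\sqrt{2}\,(n-1)!}\,\frac{1}{\sqrt{2n(2n-1)}}.$$
   Context: $L^2[0,1]$ is the complex Hilbert space of square-integrable functions on $[0,1]$. The Volterra operator $V:L^2[0,1]\to L^2[0,1]$ is defined by $Vf(x):=\int_0^x f(t)\,dt$, and its adjoint is $V^*f(x)=\int_x^1 f(t)\,dt$. For $n\ge1$, write $V^{*n}:=(V^* )^n$, $\operatorname{Re} V^n:=(V^n+V^{*n})/2$ and $\operatorname{Im} V^n:=(V^n-V^{*n})/(2i)$. $\|\cdot\|_{\mathrm{HS}}$ denotes the Hilbert--Schmidt norm of operators on $L^2[0,1]$. *)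

(* Defs.v *)
From mathcomp Require Export all_boot all_order all_algebra.
From mathcomp Require Export all_classical all_reals all_analysis.
From mathcomp Require Export complex.

Set Implicit Arguments.
Unset Strict Implicit.
Unset Printing Implicit Defensive.

Import Order.TTheory GRing.Theory Num.Theory.
Import numFieldNormedType.Exports.
Import ComplexField.Normc.

Local Open Scope classical_set_scope.
Local Open Scope ring_scope.

(* Elements of L^2[0,1] are represented by functions R -> R[i] of which only
   the values on [0, 1] matter; equality in L^2[0,1] is equality almost
   everywhere on [0, 1]. *)

Section L2_unit_interval.
Context {R : realType}.
Local Notation mu := (@lebesgue_measure R).
Implicit Types f g : R -> R[i].

Definition unit_itv : set R := `[0, 1].

Definition cintegral (D : set R) f : R[i] :=
  Complex (\int[mu]_(x in D) complex.Re (f x)) (\int[mu]_(x in D) complex.Im (f x)).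

Definition L2norm f : \bar R :=
  sqrte (\int[mu]_(x in unit_itv) ((normc (f x) ^+ 2)%:E))%E.

Definition L2 : set (R -> R[i]) :=
  [set f | [/\ measurable_fun unit_itv (fun x => complex.Re (f x)),
               measurable_fun unit_itv (fun x => complex.Im (f x)) &
               (L2norm f < +oo)%E]].

Definition L2inner f g : R[i] :=
  cintegral unit_itv (fun x => f x * (g x)^*%C).

(* An orthonormal sequence whose linear span is dense; as L^2[0,1] is separable
   and infinite-dimensional, its orthonormal bases are all sequences. *)
Definition orthonormal_basis (e : nat -> R -> R[i]) : Prop :=
  [/\ forall k, L2 (e k),
      forall j k, L2inner (e j) (e k) = (j == k)%:R &
      forall f, L2 f -> forall eps : R, 0 < eps ->
        exists (N : nat) (c : nat -> R[i]),
          (L2norm (fun x => f x - \sum_(k < N) c k * e k x)%R < eps%:E)%E].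

(* The Hilbert-Schmidt norm of T, computed in the orthonormal basis e; its value
   does not depend on the choice of the orthonormal basis. *)
Definition HSnorm (e : nat -> R -> R[i]) (T : (R -> R[i]) -> R -> R[i])
    : \bar R :=
  sqrte (\sum_(0 <= k <oo) (L2norm (T (e k)) ^+ 2))%E.

Definition volterra f : R -> R[i] :=
  fun x => cintegral `[0, x] f.

Definition volterra_adj f : R -> R[i] :=
  fun x => cintegral `[x, 1] f.

Definition Re_volterra (n : nat) f : R -> R[i] :=
  fun x => (iter n volterra f x + iter n volterra_adj f x) / 2.

Definition Im_volterra (n : nat) f : R -> R[i] :=
  fun x => (iter n volterra f x - iter n volterra_adj f x) / (2 * 'i%C).

End L2_unit_interval.

(* Main.v *)
(* V^n is the integral operator with kernel (x - t)^(n-1) / (n-1)! on t < x, and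
   V^*n has the transposed kernel. Hence, off the diagonal, Re V^n and Im V^n
   both have a kernel K of modulus |x - t|^(n-1) / (2 (n-1)!). By Parseval,
   sum_k |(T e_k)(x)|^2 = int |K(x, t)|^2 dt for each x, and integrating over x
   the Hilbert-Schmidt norm of T is the L^2 norm of K on the unit square. *)
Require Import Defs.
From mathcomp Require Import measure measurable_realfun ring lra.
Import Order.TTheory GRing.Theory Num.Theory.
Import numFieldNormedType.Exports.
Import ComplexField.Normc.
Local Open Scope classical_set_scope.
Local Open Scope ring_scope.

Set Implicit Arguments.
Unset Strict Implicit.

(** Only the moduli of [T f x] enter the norm, so the factor 1/i of Im V^n and the conjugation in
    the inner product do no harm, and both operators fall under one kernel with a sign [s]. The two
    halves of that kernel have disjoint supports, so its square depends on [s] only through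
    [s ^+ 2 = 1]: this is why the two norms agree. The square of the kernel of V^(m+1) is
    (2m)!/(m!)^2 times the kernel of V^(2m+1), and integrating a kernel over one variable in [0,1]
    gives a value of the next kernel. The double integral is therefore 1/4 (2m)!/(m!)^2 times
    2/(2m+2)!, which for n = m+1 is 1/(2 ((n-1)!)^2 2n(2n-1)). A basis is given here by density of
    its span, so Parseval has to be extracted from an exact formula for the distance to an arbitrary
    finite combination. The kernel formulas are proved at every point of [0,1], and only there,
    since representatives are arbitrary outside. *)

Section L2_unit_interval_theory.
Context {R : realType}.
Local Notation mu := (@lebesgue_measure R).
Implicit Types (f g : R -> R[i]) (h : R -> R).

Local Notation integrable1 h := (mu.-integrable unit_itv (EFin \o h)).

(** * Integrability of real functions on the unit interval *)

Lemma measurable_unit_itv : measurable (@unit_itv R).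
Proof. exact: measurable_itv. Qed.
Hint Resolve measurable_unit_itv : core.

Lemma lebesgue_measure_unit_itv : mu unit_itv = 1%E.
Proof. by rewrite /unit_itv lebesgue_measure_itv /= lte_fin ltr01 sube0. Qed.

(** Measurability of [h] is a separate clause because that of its square does not imply it. *)
Definition square_integrable h :=
  measurable_fun unit_itv h /\ integrable1 (fun x => h x ^+ 2).

Lemma integrable1_bounded h h' : measurable_fun unit_itv h ->
  (forall x, unit_itv x -> `|h x| <= h' x) -> integrable1 h' -> integrable1 h.
Proof.
move=> mh hb; apply: le_integrable => //; first exact/measurable_EFinP.
move=> x Ux /=; rewrite lee_fin; apply: le_trans (hb _ Ux) _; exact: ler_norm.
Qed.

Lemma integrable1Z (c : R) h : integrable1 h -> integrable1 (fun x => c * h x).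
Proof.
by move=> ih;
  have := @integrableZl _ _ R mu _ measurable_unit_itv c _ ih.
Qed.

Lemma integrable1D h h' : integrable1 h -> integrable1 h' ->
  integrable1 (fun x => h x + h' x).
Proof.
by move=> ih ih';
  have := @integrableD _ _ R mu _ measurable_unit_itv _ _ ih ih'.
Qed.

Lemma integrable1B h h' : integrable1 h -> integrable1 h' ->
  integrable1 (fun x => h x - h' x).
Proof.
by move=> ih ih';
  have := @integrableB _ _ R mu _ measurable_unit_itv _ _ ih ih'.
Qed.

(** The product is dominated through |ab| <= a^2 + b^2. *)
Lemma square_integrableM h h' : square_integrable h -> square_integrable h' ->
  integrable1 (fun x => h x * h' x).
Proof.
move=> [mh ih] [mh' ih'].
apply: (integrable1_bounded (h' := fun x => h x ^+ 2 + h' x ^+ 2)).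
- exact: measurable_funM.
- move=> x _; rewrite ler_norml; apply/andP; split; nra.
- exact: integrable1D.
Qed.

Lemma square_integrable_cst (c : R) : square_integrable (fun=> c).
Proof.
split => //; apply/integrableP; split; first exact/measurable_EFinP.
by under eq_integral do rewrite /=; 
  rewrite integral_cst// [X in (_ * X)%E]lebesgue_measure_unit_itv mule1 ltry.
Qed.

(** The interval has finite measure, so 1 is square integrable and [h] is the product [h * 1]. *)
Lemma square_integrable_integrable h : square_integrable h -> integrable1 h.
Proof.
move=> sh; rewrite (_ : EFin \o h = EFin \o (fun x => h x * 1)).
  by apply: square_integrableM => //; exact: square_integrable_cst.
by apply/funext => x /=; rewrite mulr1.
Qed.

Lemma square_integrableZ (c : R) h :
  square_integrable h -> square_integrable (fun x => c * h x).
Proof.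
move=> [mh ih]; split; first exact: measurable_funM.
rewrite (_ : EFin \o _ = EFin \o (fun x => c ^+ 2 * h x ^+ 2)).
  exact: integrable1Z.
by apply/funext => x /=; rewrite exprMn.
Qed.

Lemma square_integrableB h h' : square_integrable h -> square_integrable h' ->
  square_integrable (fun x => h x - h' x).
Proof.
move=> sh sh'; split; first exact: measurable_funB sh.1 sh'.1.
rewrite (_ : EFin \o _ =
    EFin \o (fun x => h x ^+ 2 - 2 * (h x * h' x) + h' x ^+ 2)).
  apply: integrable1D sh'.2; apply: integrable1B sh.2 _.
  exact/integrable1Z/square_integrableM.
by apply/funext => x /=; congr EFin; ring.
Qed.

(** * Squared norm and inner product of complex functions *)

Lemma normc_sqr (z : R[i]) :
  normc z ^+ 2 = complex.Re z ^+ 2 + complex.Im z ^+ 2.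
Proof. by case: z => a b /=; rewrite sqr_sqrtr ?addr_ge0 ?sqr_ge0. Qed.

Lemma measurable_normc_sqr f (D : set R) :
  measurable_fun D (fun x => complex.Re (f x)) ->
  measurable_fun D (fun x => complex.Im (f x)) ->
  measurable_fun D (fun x => normc (f x) ^+ 2).
Proof.
move=> mR mI; under eq_fun do rewrite normc_sqr.
by apply: measurable_funD; exact: measurable_funX.
Qed.

Lemma L2norm_sqr f :
  (L2norm f ^+ 2 = \int[mu]_(x in unit_itv) (normc (f x) ^+ 2)%:E)%E.
Proof.
by rewrite sqr_sqrte// integral_ge0// => x _; rewrite lee_fin sqr_ge0.
Qed.

(** Each of the two squares is dominated by |f|^2, which is their sum. This lets all complex
    statements below be proved by real integration. *)
Lemma L2P f : L2 f <-> square_integrable (fun x => complex.Re (f x)) /\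
                       square_integrable (fun x => complex.Im (f x)).
Proof.
split=> [[mR mI L2f]|[[mR iR] [mI iI]]].
  have intf : integrable1 (fun x => normc (f x) ^+ 2).
    apply/integrableP; split.
      by apply/measurable_EFinP; exact: measurable_normc_sqr.
    under eq_integral => x _ do rewrite /= ger0_norm ?sqr_ge0//.
    have f0 := @L2norm_sqr f; rewrite -f0.
    have : (0 <= L2norm f)%E by exact: sqrte_ge0.
    by case: (L2norm f) L2f => //= r _ _; rewrite ltry.
  split; split => //; apply: integrable1_bounded intf.
  - exact: measurable_funX.
  - by move=> x _; rewrite normc_sqr ger0_norm ?sqr_ge0// lerDl sqr_ge0.
  - exact: measurable_funX.
  - by move=> x _; rewrite normc_sqr ger0_norm ?sqr_ge0// lerDr sqr_ge0.
split => //.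
have intf : integrable1 (fun x => normc (f x) ^+ 2).
  by under eq_fun do rewrite normc_sqr; exact: integrable1D.
rewrite /L2norm.
have /fineK <- := @integrable_fin_num _ _ R mu _ measurable_unit_itv _ intf.
by rewrite ltry.
Qed.

Local Notation I h := (\int[mu]_(x in unit_itv) h x).

Lemma RintegralZ1 (c : R) h : integrable1 h -> I (fun x => c * h x) = c * I h.
Proof. exact: (@RintegralZl _ _ R mu _ _ c measurable_unit_itv). Qed.

Lemma RintegralD1 h h' : integrable1 h -> integrable1 h' ->
  I (fun x => h x + h' x) = I h + I h'.
Proof. exact: (@RintegralD _ _ R mu _ _ _ measurable_unit_itv). Qed.

Lemma RintegralB1 h h' : integrable1 h -> integrable1 h' ->
  I (fun x => h x - h' x) = I h - I h'.
Proof. exact: (@RintegralB _ _ R mu _ _ _ measurable_unit_itv). Qed.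

Lemma L2innerE f g : L2 f -> L2 g -> L2inner f g = Complex
  (I (fun x => complex.Re (f x) * complex.Re (g x)) +
   I (fun x => complex.Im (f x) * complex.Im (g x)))
  (I (fun x => complex.Im (f x) * complex.Re (g x)) -
   I (fun x => complex.Re (f x) * complex.Im (g x))).
Proof.
move=> /L2P[fR fI] /L2P[gR gI].
rewrite -RintegralD1; [|exact: square_integrableM..].
rewrite -RintegralB1; [|exact: square_integrableM..].
rewrite /L2inner /cintegral; congr Complex; apply: eq_Rintegral => x _;
  case: (f x) => a b; case: (g x) => c d /=; ring.
Qed.

Lemma L2BZ f g (c : R[i]) : L2 f -> L2 g -> L2 (fun x => f x - c * g x).
Proof.
move=> /L2P[fR fI] /L2P[gR gI]; apply/L2P; case: c => a b; split.
- rewrite (_ : (fun x => _) = fun x => complex.Re (f x) -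
    (a * complex.Re (g x) - b * complex.Im (g x))).
    by do 2 (apply: square_integrableB => //); exact: square_integrableZ.
  by apply/funext => x; case: (f x) => ? ?; case: (g x).
- rewrite (_ : (fun x => _) = fun x => (complex.Im (f x) -
    a * complex.Im (g x)) - b * complex.Re (g x)).
    by apply: square_integrableB; [apply: square_integrableB => //|];
      exact: square_integrableZ.
  apply/funext => x; case: (f x) => ? ?; case: (g x) => ? ? /=; ring.
Qed.

Lemma L2innerBZ f g k (c : R[i]) : L2 f -> L2 g -> L2 k ->
  L2inner (fun x => f x - c * g x) k = L2inner f k - c * L2inner g k.
Proof.
move=> Lf Lg Lk; have Lfg := L2BZ c Lf Lg.
move: (Lf) (Lg) (Lk) => /L2P[fR fI] /L2P[gR gI] /L2P[kR kI].
rewrite !L2innerE//; case: c Lfg => a b _ /=.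
(* Both parts of [f - c * g] have the shape [h1 - (s * h2 + t * h3)], so this one linearity rule
   serves all four integrals of the inner product. *)
have P h1 h2 h3 h4 (s t : R) :
    square_integrable h1 -> square_integrable h2 -> square_integrable h3 ->
    square_integrable h4 ->
    I (fun x => (h1 x - (s * h2 x + t * h3 x)) * h4 x) =
    I (fun x => h1 x * h4 x) -
    (s * I (fun x => h2 x * h4 x) + t * I (fun x => h3 x * h4 x)).
  move=> s1 s2 s3 s4; rewrite -!RintegralZ1; [|exact: square_integrableM..].
  rewrite -RintegralD1; [|exact/integrable1Z/square_integrableM..].
  rewrite -RintegralB1; first by apply: eq_Rintegral => x _; ring.
    exact: square_integrableM.
  by apply: integrable1D; exact/integrable1Z/square_integrableM.
have eR : (fun x => complex.Re (f x - Complex a b * g x)) = fun x =>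
    complex.Re (f x) - (a * complex.Re (g x) + - b * complex.Im (g x)).
  by apply/funext => x; case: (f x) => ? ?; case: (g x) => ? ? /=; ring.
have eI : (fun x => complex.Im (f x - Complex a b * g x)) = fun x =>
    complex.Im (f x) - (a * complex.Im (g x) + b * complex.Re (g x)).
  by apply/funext => x; case: (f x) => ? ?; case: (g x) => ? ? /=; ring.
have eRx x := congr1 (@^~ x) eR; have eIx x := congr1 (@^~ x) eI.
rewrite /= in eRx eIx.
under eq_Rintegral do rewrite eRx.
under [X in _ + X]eq_Rintegral do rewrite eIx.
under [X in Complex _ (X - _)]eq_Rintegral do rewrite eIx.
under [X in Complex _ (_ - X)]eq_Rintegral do rewrite eRx.
rewrite !P//; apply/eqP; rewrite eq_complex /=.
by apply/andP; split; apply/eqP; ring.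
Qed.

(** A real-valued squared norm. An infinite integral would be read as 0, so it is tied to [L2norm]
    only for [f] in [L2]. *)
Definition L2sqr f : R := I (fun x => normc (f x) ^+ 2).

Lemma L2sqrE f : L2 f -> L2sqr f =
  I (fun x => complex.Re (f x) ^+ 2) + I (fun x => complex.Im (f x) ^+ 2).
Proof.
move=> /L2P[[_ fR] [_ fI]]; rewrite -RintegralD1//.
by apply: eq_Rintegral => x _; rewrite normc_sqr.
Qed.

Lemma integral_normc_sqr f : L2 f ->
  (\int[mu]_(x in unit_itv) (normc (f x) ^+ 2)%:E)%E = (L2sqr f)%:E.
Proof.
move=> /L2P[[_ fR] [_ fI]]; rewrite fineK//.
apply: (@integrable_fin_num _ _ R mu _ measurable_unit_itv).
by under eq_fun do rewrite normc_sqr; exact: integrable1D.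
Qed.

Lemma L2sqr_inner f : L2 f -> L2inner f f = Complex (L2sqr f) 0.
Proof.
move=> Lf; rewrite L2innerE// L2sqrE//; congr Complex.
by apply/eqP; rewrite subr_eq0; apply/eqP/eq_Rintegral => x _; rewrite mulrC.
Qed.

(** * Orthonormal expansions and Parseval *)

Lemma L2inner_conj f g : L2 f -> L2 g -> L2inner g f = (L2inner f g)^*%C.
Proof.
move=> Lf Lg; rewrite !L2innerE//=; apply/eqP; rewrite eq_complex /= opprB.
by apply/andP; split; apply/eqP; congr (_ + _); try congr (- _);
  apply: eq_Rintegral => x _; rewrite mulrC.
Qed.

(** Completing the square in [c]: the minimum is reached at the Fourier coefficient, and the last
    term measures the deviation from it. *)
Lemma L2sqrBZ f g (c : R[i]) : L2 f -> L2 g -> L2inner g g = 1 ->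
  L2sqr (fun x => f x - c * g x) =
  L2sqr f - normc (L2inner f g) ^+ 2 + normc (c - L2inner f g) ^+ 2.
Proof.
move=> Lf Lg g1; have Lfg := L2BZ c Lf Lg.
have /(congr1 (@complex.Re R)) := L2sqr_inner Lfg; rewrite [X in _ = X -> _]/=.
rewrite L2innerBZ// [L2inner f _]L2inner_conj// [L2inner g _]L2inner_conj//.
rewrite !L2innerBZ// g1 [L2inner g f]L2inner_conj// L2sqr_inner// => <-.
rewrite !normc_sqr; case: (L2inner f g) => u v; case: c {Lfg} => a b /=; ring.
Qed.

(** Induction on [N], removing one term at a time. The second clause is what carries the induction:
    subtracting earlier terms leaves the later coefficients of [f] unchanged. Arbitrary [c] are
    allowed because density supplies coefficients that need not be the Fourier ones. *)
Lemma L2_distance_to_span (e : nat -> R -> R[i]) (c : nat -> R[i]) f N :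
    (forall k, L2 (e k)) -> (forall j k, L2inner (e j) (e k) = (j == k)%:R) ->
    L2 f ->
  [/\ L2 (fun x => f x - \sum_(k < N) c k * e k x),
     forall j, (N <= j)%N ->
       L2inner (fun x => f x - \sum_(k < N) c k * e k x) (e j) =
       L2inner f (e j) &
     L2sqr (fun x => f x - \sum_(k < N) c k * e k x) =
       L2sqr f - \sum_(k < N) normc (L2inner f (e k)) ^+ 2
         + \sum_(k < N) normc (c k - L2inner f (e k)) ^+ 2].
Proof.
move=> Le oe Lf; elim: N => [|N [LN iN nN]].
  have -> : (fun x => f x - \sum_(k < 0) c k * e k x) = f.
    by apply/funext => x; rewrite big_ord0 subr0.
  by split => //; rewrite !big_ord0 subr0 addr0.
have -> : (fun x => f x - \sum_(k < N.+1) c k * e k x) =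
    fun x => (f x - \sum_(k < N) c k * e k x) - c N * e N x.
  by apply/funext => x; rewrite big_ord_recr /= opprD addrA.
split; first exact: L2BZ.
- move=> j Nj; rewrite L2innerBZ// oe (ltn_eqF Nj) mulr0 subr0 iN//.
  exact: ltnW.
- rewrite L2sqrBZ// ?oe ?eqxx// nN iN// !big_ord_recr /=; ring.
Qed.

Lemma L2_parseval (e : nat -> R -> R[i]) f : orthonormal_basis e -> L2 f ->
  (\sum_(0 <= k <oo) (normc (L2inner f (e k)) ^+ 2)%:E)%E = (L2sqr f)%:E.
Proof.
move=> [Le oe de] Lf.
have s0 k : (0 <= (normc (L2inner f (e k)) ^+ 2)%:E :> \bar R)%E.
  by rewrite lee_fin sqr_ge0.
have L2sqr_ge0 g : 0 <= L2sqr g by apply: Rintegral_ge0 => x _; exact: sqr_ge0.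
apply/eqP; rewrite eq_le; apply/andP; split.
  (* Bessel's inequality: with the Fourier coefficients as [c] the deviation term vanishes, and what
     remains is a squared norm. *)
  apply: lime_le; first exact: is_cvg_nneseries.
  apply: nearW => N; rewrite big_mkord sumEFin lee_fin -subr_ge0.
  have [_ _] := L2_distance_to_span (fun k => L2inner f (e k)) N Le oe Lf.
  rewrite [X in _ + X]big1 => [|k _]; last by rewrite subrr normc0 expr0n.
  by rewrite addr0 => <-.
apply/lee_addgt0Pr => r r0.
(* An approximation within [Num.sqrt r] makes the squared distance less than [r]; dropping the
   nonnegative deviation term bounds [L2sqr f] by a partial sum plus [r]. *)
have [N [c]] := de f Lf (Num.sqrt r) ltac:(by rewrite sqrtr_gt0).
have [LN _ nN] := L2_distance_to_span c N Le oe Lf.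
rewrite /L2norm integral_normc_sqr// lte_fin ltr_sqrt// nN => hr.
apply: le_trans (leeD (nneseries_lim_ge N _) (lexx _)) => //.
rewrite big_mkord sumEFin -EFinD lee_fin.
have : 0 <= \sum_(k < N) normc (c k - L2inner f (e k)) ^+ 2.
  by apply: sumr_ge0 => k _; exact: sqr_ge0.
lra.
Qed.

(** * Integrals of powers of affine functions *)

Lemma integral_derive (F f : R -> R) (a b : R) : a <= b ->
  (forall x, is_derive x (1 : R) F (f x)) -> continuous f ->
  (\int[mu]_(x in `[a, b]) (f x)%:E)%E = (F b - F a)%:E.
Proof.
(* The fundamental theorem is applied for [a < b]; a degenerate interval is a null set. *)
rewrite le_eqVlt => /predU1P[<- _ _|ab dF cf].
  by rewrite set_itv1 integral_set1 subrr.
have cF : continuous F.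
  move=> x; apply/differentiable_continuous/derivable1_diffP.
  by apply: ex_derive.
rewrite (@continuous_FTC2 _ f F)//.
- exact: continuous_subspaceT.
- split.
  + by move=> x _; apply: ex_derive.
  + exact/cvg_at_right_filter/cF.
  + exact/cvg_at_left_filter/cF.
- by move=> x _; rewrite derive1E; apply: derive_val.
Qed.

(** The affine form [u + v * s] covers x - s (with [v = -1]) and s - t (with [v = 1]), hence
    integration in either variable of the kernel. *)
Lemma continuous_pow_affine (u v : R) (m : nat) :
  continuous (fun s : R => (u + v * s) ^+ m / m`!%:R).
Proof.
move=> x; apply: cvgM; last exact: cvg_cst.
apply: (@cvg_comp _ _ _ (fun s : R => u + v * s) (fun y => y ^+ m)).
  apply: cvgD; first exact: cvg_cst.
  by apply: cvgM; [exact: cvg_cst|exact: cvg_id].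
exact: exprn_continuous.
Qed.

Lemma is_derive_pow_affine (u v : R) (m : nat) (x : R) : v != 0 ->
  is_derive x (1 : R) (fun s : R => (u + v * s) ^+ m.+1 / (v * m.+1`!%:R))
    ((u + v * x) ^+ m / m`!%:R).
Proof.
move=> v0.
rewrite (_ : (fun s : R => _) =
    (v * m.+1`!%:R)^-1 *: (cst u + v *: id : R -> R) ^+ m.+1); last first.
  by apply/funext => s; rewrite scalrfctE exprfctE [LHS]mulrC.
have dE : is_derive x (1 : R) (cst u + v *: id : R -> R) (0 + v *: 1).
  exact: is_deriveD.
apply: is_derive_eq (is_deriveZ _ (is_deriveX m.+1 dE)) _.
rewrite factS natrM add0r /GRing.scale /= /GRing.scale /= mulr1.
have : m.+1%:R != 0 :> R by rewrite pnatr_eq0.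
have : m`!%:R != 0 :> R by rewrite pnatr_eq0 -lt0n fact_gt0.
by move=> ? ?; field; apply/and3P.
Qed.

Lemma integral_pow_affine (u v : R) (m : nat) (a b : R) : v != 0 -> a <= b ->
  (\int[mu]_(s in `[a, b]) ((u + v * s) ^+ m / m`!%:R)%:E)%E =
  (((u + v * b) ^+ m.+1 - (u + v * a) ^+ m.+1) / (v * m.+1`!%:R))%:E.
Proof.
move=> v0 ab; rewrite mulrBl.
apply: (@integral_derive (fun s => (u + v * s) ^+ m.+1 / (v * m.+1`!%:R))
  (fun s => (u + v * s) ^+ m / m`!%:R)) => //.
- by move=> x; exact: is_derive_pow_affine.
- exact: continuous_pow_affine.
Qed.

(** * Kernels of the powers of V: bounds, composition, integrals in one variable *)

Lemma unit_itvE (x : R) : unit_itv x <-> 0 <= x <= 1.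
Proof. by rewrite /unit_itv /= in_itv. Qed.

(** Strict inequalities in the kernel give open or half-open supports. Endpoints are null, so every
    such integral is compared with the one over []a, b[] and then closed up. *)
Lemma Rintegral_unit_itv_patch (h k : R -> R) (b0 b1 : bool) (a b : R) :
    continuous h -> 0 <= a -> b <= 1 ->
    {in unit_itv, k =1 h \_ [set` Interval (BSide b0 a) (BSide b1 b)]} ->
  I k = \int[mu]_(x in `[a, b]) h x.
Proof.
move=> ch a0 b1' kh; have -> := eq_Rintegral mu kh; rewrite -Rintegral_mkcondr.
rewrite setIidr; last first.
  apply: subset_itvScc; rewrite bnd_simp//.
have mh (D : set R) : measurable D -> measurable_fun D (EFin \o h).
  move=> mD; apply/measurable_EFinP.
  by apply: measurable_funS (continuous_measurable_fun ch).
have moo : measurable_fun `]a, b[ (EFin \o h).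
  by apply: mh; exact: measurable_itv.
congr fine; apply: (etrans (integral_itv_bndoo b0 b1 moo)).
exact: (esym (integral_itv_bndoo true false moo)).
Qed.

(* The kernel of V^(m+1). With a strict inequality, the kernel and its transpose
   have disjoint supports, also for m = 0. *)
Definition volterra_kernel (m : nat) (x t : R) : R :=
  if t < x then (x - t) ^+ m / m`!%:R else 0.

Lemma volterra_kernel_ge0 m x t : 0 <= volterra_kernel m x t.
Proof.
rewrite /volterra_kernel; case: ifP => // tx.
by rewrite divr_ge0// exprn_ge0// subr_ge0 ltW.
Qed.

(** A uniform bound on the unit square, which supplies the domination for all later uses of
    Fubini. *)
Lemma volterra_kernel_le1 m x t : unit_itv x -> unit_itv t ->
  `|volterra_kernel m x t| <= 1.
Proof.
move=> /unit_itvE/andP[x0 x1] /unit_itvE/andP[t0 t1].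
rewrite ger0_norm ?volterra_kernel_ge0// /volterra_kernel; case: ifP => // tx.
rewrite ler_pdivrMr ?mul1r ?ltr0n ?fact_gt0//.
apply: (@le_trans _ _ 1); last by rewrite ler1n fact_gt0.
by apply: exprn_ile1; lra.
Qed.

(** General [u] and [v] make this serve for sections as well as for joint measurability, in either
    order of the variables. *)
Lemma measurable_volterra_kernel m d (T : measurableType d) (u v : T -> R) :
  measurable_fun setT u -> measurable_fun setT v ->
  measurable_fun setT (fun s => volterra_kernel m (u s) (v s)).
Proof.
move=> mu_ mv; apply: measurable_fun_ifT => //; first exact: measurable_fun_ltr.
by apply: measurable_funM => //; apply: measurable_funX; exact: measurable_funB.
Qed.

(** This is the composition of V with V^(m+1) at the level of kernels: the integrand lives on t < s
    < x, where the first factor is 1. *)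
Lemma Rintegral_volterra_kernelM m x t : unit_itv x -> unit_itv t ->
  I (fun s => volterra_kernel 0 x s * volterra_kernel m s t) =
  volterra_kernel m.+1 x t.
Proof.
move=> /unit_itvE/andP[x0 x1] /unit_itvE/andP[t0 t1].
rewrite {3}/volterra_kernel; case: ifPn => [tx|]; last first.
  rewrite -leNgt => xt; rewrite (@eq_Rintegral _ _ _ _ _ (cst 0)).
    by rewrite /Rintegral integral0.
  move=> s _; rewrite /volterra_kernel/=.
  case: ifPn => sx; last by rewrite mul0r.
  by rewrite ltNge (ltW (lt_le_trans sx xt)) mulr0.
(* The booleans [false true] encode the open interval []t, x[]. *)
rewrite (@Rintegral_unit_itv_patch
  (fun s => (- t + 1 * s) ^+ m / m`!%:R) _ false true t x)//.
- rewrite /Rintegral integral_pow_affine ?oner_neq0//; last exact: ltW.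
  by rewrite !mul1r addNr expr0n subr0 (addrC (- t)).
- exact: continuous_pow_affine.
- move=> s _; rewrite patchE /volterra_kernel mem_setE in_itv /=.
  case: (ltP s x); case: (ltP t s) => //= _ _;
    rewrite ?mul0r ?mulr0//.
  by rewrite expr0 fact0 divr1 !mul1r (addrC s).
Qed.

Lemma Rintegral_volterra_kernel_r m x : unit_itv x ->
  I (fun t => volterra_kernel m x t) = x ^+ m.+1 / m.+1`!%:R.
Proof.
move=> /unit_itvE/andP[x0 x1].
rewrite (@Rintegral_unit_itv_patch
  (fun s => (x + (-1) * s) ^+ m / m`!%:R) _ true true 0 x)//.
- rewrite /Rintegral integral_pow_affine ?oppr_eq0 ?oner_neq0//=.
  by rewrite !mulN1r oppr0 addr0 subrr expr0n sub0r invrN mulrNN.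
- exact: continuous_pow_affine.
- move=> s /set_mem/unit_itvE/andP[s0 s1].
  by rewrite patchE /volterra_kernel mem_setE in_itv /= s0 mulN1r.
Qed.

Lemma Rintegral_volterra_kernel_l m x : unit_itv x ->
  I (fun t => volterra_kernel m t x) = (1 - x) ^+ m.+1 / m.+1`!%:R.
Proof.
move=> /unit_itvE/andP[x0 x1].
rewrite (@Rintegral_unit_itv_patch
  (fun s => (- x + 1 * s) ^+ m / m`!%:R) _ false false x 1)//.
- rewrite /Rintegral integral_pow_affine ?oner_neq0//=.
  by rewrite !mul1r addNr expr0n subr0 addrC.
- exact: continuous_pow_affine.
- move=> s /set_mem/unit_itvE/andP[s0 s1].
  by rewrite patchE /volterra_kernel mem_setE in_itv /= s1 andbT mul1r addrC.
Qed.

(** * Exchanging the order of integration *)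

Lemma integrable1_boundedM (k h : R -> R) : measurable_fun unit_itv k ->
  (forall t, unit_itv t -> `|k t| <= 1) -> integrable1 h ->
  integrable1 (fun t => k t * h t).
Proof.
move=> mk k1 ih; have /integrableP[/measurable_EFinP mh _] := ih.
apply: (integrable1_bounded (h' := fun t => `|h t|)).
- exact: measurable_funM.
- by move=> t Ut; rewrite normrM ler_piMl// k1.
- exact: (@integrable_norm _ _ R mu _ _ ih).
Qed.

(** The exchange composes kernels. The integrability clause is needed as well: it allows the
    operator to be applied again, and later yields measurability in the outer variable. *)
Lemma Fubini_unit_itv (k : R -> R -> R) h :
    measurable_fun setT (fun z : R * R => k z.1 z.2) ->
    (forall s t, unit_itv s -> unit_itv t -> `|k s t| <= 1) ->
    integrable1 h ->
  integrable1 (fun s => I (fun t => k s t * h t)) /\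
  I (fun s => I (fun t => k s t * h t)) = I (fun t => I (fun s => k s t) * h t).
Proof.
move=> mk k1 ih; have /integrableP[/measurable_EFinP mh fh] := ih.
pose nh t := `|h t|.
(* Extension by zero to the whole plane, since nothing is assumed of [h] outside the interval and
   [k] is bounded only on the square. *)
pose F (z : R * R) : \bar R :=
  (\1_(@unit_itv R) z.1 * (k z.1 z.2 * (h \_ unit_itv) z.2))%:E.
have mU (w : R -> R) :
    measurable_fun unit_itv w -> measurable_fun setT (w \_ unit_itv).
  exact: (@measurable_restrictT _ _ _ _ unit_itv w measurable_unit_itv).1.
have mF : measurable_fun setT F.
  apply/measurable_EFinP; apply: measurable_funM.
    exact: (measurableT_comp (measurable_indic measurable_unit_itv)
                             measurable_fst).
  apply: measurable_funM => //.
  exact: (measurableT_comp (mU h mh) measurable_snd).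
have mk1 s : measurable_fun unit_itv (k s).
  exact: measurable_funS (measurable_fun_pair2 s mk).
have mk2 t : measurable_fun unit_itv (k^~ t).
  exact: measurable_funS (measurable_fun_pair1 t mk).
have fineI w : integrable1 w ->
    (\int[mu]_t ((w \_ unit_itv) t)%:E)%E = (I w)%:E.
  move=> iw; rewrite fineK.
    by rewrite [RHS]integral_mkcond restrict_EFin.
  exact: (@integrable_fin_num _ _ R mu _ measurable_unit_itv _ iw).
have int0 (G : R -> \bar R) : (forall t, G t = 0%E) -> (\int[mu]_t G t)%E = 0%E.
  by move=> G0; apply: integral0_eq => t _.
have indicU s : unit_itv s -> \1_unit_itv s = 1 :> R.
  by move=> Us; rewrite indicE mem_set.
have indicN s : ~ unit_itv s -> \1_unit_itv s = 0 :> R.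
  by move=> Us; rewrite indicE memNset.
have FE s : (\int[mu]_t F (s, t))%E =
    (((fun s => I (fun t => k s t * h t)) \_ unit_itv) s)%:E.
  rewrite patchE; case: ifPn => [/set_mem Us|/negP Us].
    rewrite -fineI; last by apply: integrable1_boundedM => // t; exact: k1.
    apply: eq_integral => t _; rewrite /F/= indicU// mul1r !patchE.
    by case: ifP => //; rewrite mulr0.
  by apply: int0 => t; rewrite /F/= indicN ?mul0r// => /mem_set.
have GE t : (\int[mu]_s F (s, t))%E =
    (((fun t => I (k^~ t) * h t) \_ unit_itv) t)%:E.
  rewrite patchE; case: ifPn => [Ut|Ut].
    have ik : integrable1 (fun s => k s t).
      rewrite (_ : EFin \o _ = EFin \o (fun s => k s t * 1)).
        apply: integrable1_boundedM => // [s Us|]; first exact/k1/set_mem.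
        exact/square_integrable_integrable/square_integrable_cst.
      by apply/funext => s /=; rewrite mulr1.
    rewrite mulrC -RintegralZ1// -fineI; last exact: integrable1Z.
    apply: eq_integral => s _; rewrite /F/= indicE !patchE Ut.
    by case: ifP => _; rewrite ?mul1r ?mul0r// mulrC.
  by apply: int0 => s; rewrite /F/= patchE (negbTE Ut) !mulr0.
have iF : (mu \x mu)%E.-integrable setT F.
  apply: (integrable12ltyP mu mu mF).2.
  have ih1 : integrable1 nh := @integrable_norm _ _ R mu _ _ ih.
  (* For [s] in the interval the inner integral of |F| is at most the integral of |h|, and otherwise
     it is 0; a constant on a set of measure 1 has finite integral. *)
  apply: (@le_lt_trans _ _ (\int[mu]_s ((cst (I nh) \_ unit_itv) s)%:E)%E).
    apply: ge0_le_integral => //.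
    - by move=> s _; apply: integral_ge0.
    - apply: (@measurable_fun_fubini_tonelli_F _ _ _ _ R mu
        (fun z => `|F z|%E)) => //.
      exact: measurableT_comp.
    - by apply/measurable_EFinP; exact: mU.
    - move=> s _; rewrite patchE; case: ifPn => [/set_mem Us|/negP Us].
        rewrite -fineI//; apply: ge0_le_integral => //.
        + apply: (@measurableT_comp _ _ _ _ _ _ abse _
            (fun t => F (s, t))) => //.
          exact: (measurable_fun_pair2 s mF).
        + apply/measurable_EFinP; refine (mU nh _).
          refine (@measurableT_comp _ _ _ _ _ _ (fun r : R => `|r|) _ h _ mh).
          exact: normr_measurable.
        + move=> t _; rewrite /F/= lee_fin indicU// mul1r !patchE.
          case: ifPn => [/set_mem Ut|_]; last by rewrite mulr0 normr0.
          by rewrite normrM ler_piMl// k1.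
      by rewrite int0 ?lexx// => t;
        rewrite /F/= indicN ?mul0r ?normr0// => /mem_set.
  rewrite fineI ?ltry//.
  exact/square_integrable_integrable/square_integrable_cst.
split.
  have := integrable_fubini_F iF.
  rewrite /fubini_F; under eq_fun do rewrite FE.
  move=> iFE.
  apply: (@integrable_mkcond _ _ R mu _
    (EFin \o (fun s => I (fun t => k s t * h t))) measurable_unit_itv).2.
  by rewrite restrict_EFin.
have := Fubini iF.
under eq_integral do rewrite FE.
under [RHS]eq_integral do rewrite GE.
move=> FG; rewrite [LHS]Rintegral_mkcond [RHS]Rintegral_mkcond.
exact: (congr1 fine FG).
Qed.

(** * Iterates of V and of its adjoint as integral operators *)

Definition rvolterra h : R -> R := fun x => \int[mu]_(t in `[0, x]) h t.

Definition rvolterra_adj h : R -> R := fun x => \int[mu]_(t in `[x, 1]) h t.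

Lemma iter_volterraE n f x : iter n volterra f x =
  Complex (iter n rvolterra (fun t => complex.Re (f t)) x)
          (iter n rvolterra (fun t => complex.Im (f t)) x).
Proof.
elim: n x => [|n IHn] x /=; first by case: (f x).
by rewrite {1}/volterra /cintegral; congr Complex; apply: eq_Rintegral => t _;
  rewrite IHn.
Qed.

Lemma iter_volterra_adjE n f x : iter n volterra_adj f x =
  Complex (iter n rvolterra_adj (fun t => complex.Re (f t)) x)
          (iter n rvolterra_adj (fun t => complex.Im (f t)) x).
Proof.
elim: n x => [|n IHn] x /=; first by case: (f x).
by rewrite {1}/volterra_adj /cintegral; congr Complex;
  apply: eq_Rintegral => t _; rewrite IHn.
Qed.

Lemma integrable1S h (D : set R) : measurable D -> D `<=` unit_itv ->
  integrable1 h -> mu.-integrable D (EFin \o h).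
Proof.
move=> mD DU ih.
exact: (@integrableS _ _ R mu _ _ _ measurable_unit_itv mD DU ih).
Qed.

Lemma rvolterraE h x : integrable1 h -> unit_itv x ->
  rvolterra h x = I (fun t => volterra_kernel 0 x t * h t).
Proof.
move=> ih /unit_itvE/andP[x0 x1].
have sU : `[0, x[ `<=` @unit_itv R.
  by apply: subset_itvScc; rewrite bnd_simp.
(* The endpoint [x] is dropped to match the strict inequality of the kernel. *)
rewrite /rvolterra -Rintegral_itv_bndo_bndc; last first.
  by apply: integrable1S => //; exact: measurable_itv.
rewrite -[X in Rintegral _ X _](setIidr sU) Rintegral_mkcondr.
apply: eq_Rintegral => t /set_mem/unit_itvE/andP[t0 t1].
rewrite patchE mem_setE in_itv/= t0 /= /volterra_kernel expr0 fact0 divr1.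
by case: ifP; rewrite ?mul1r ?mul0r.
Qed.

Lemma rvolterra_adjE h x : integrable1 h -> unit_itv x ->
  rvolterra_adj h x = I (fun t => volterra_kernel 0 t x * h t).
Proof.
move=> ih /unit_itvE/andP[x0 x1].
have sU : `]x, 1] `<=` @unit_itv R.
  by apply: subset_itvScc; rewrite bnd_simp.
rewrite /rvolterra_adj -Rintegral_itv_obnd_cbnd; last first.
  by apply: integrable1S => //; exact: measurable_itv.
rewrite -[X in Rintegral _ X _](setIidr sU) Rintegral_mkcondr.
apply: eq_Rintegral => t /set_mem/unit_itvE/andP[t0 t1].
rewrite patchE mem_setE in_itv/= t1 andbT /volterra_kernel expr0 fact0 divr1.
by case: ifP; rewrite ?mul1r ?mul0r.
Qed.

Lemma measurable_volterra_kernel_r m x D :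
  measurable_fun D (fun t : R => volterra_kernel m x t).
Proof.
apply: measurable_funTS; exact: measurable_volterra_kernel.
Qed.

Lemma measurable_volterra_kernel_l m x D :
  measurable_fun D (fun t : R => volterra_kernel m t x).
Proof.
apply: measurable_funTS; exact: measurable_volterra_kernel.
Qed.

Lemma integrable1_kernelM_r m x h : unit_itv x -> integrable1 h ->
  integrable1 (fun t => volterra_kernel m x t * h t).
Proof.
move=> Ux; apply: integrable1_boundedM.
  exact: measurable_volterra_kernel_r.
by move=> t; exact: volterra_kernel_le1.
Qed.

Lemma integrable1_kernelM_l m x h : unit_itv x -> integrable1 h ->
  integrable1 (fun t => volterra_kernel m t x * h t).
Proof.
move=> Ux; apply: integrable1_boundedM.
  exact: measurable_volterra_kernel_l.
by move=> t Ut; exact: volterra_kernel_le1.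
Qed.

Lemma measurable_kernel_pair m :
  measurable_fun setT (fun z : R * R => volterra_kernel m z.1 z.2).
Proof. exact: measurable_volterra_kernel. Qed.

Lemma measurable_kernel_pair_swap m :
  measurable_fun setT (fun z : R * R => volterra_kernel m z.2 z.1).
Proof. exact: measurable_volterra_kernel. Qed.

Lemma eq_integrable1 h h' : {in unit_itv, h =1 h'} ->
  integrable1 h -> integrable1 h'.
Proof.
move=> hh'; apply: (@eq_integrable _ _ R mu _ measurable_unit_itv) => x Ux /=.
by rewrite hh'.
Qed.

(** The outermost V is peeled off; Fubini then turns the iterated integral into a composition of
    kernels. *)
Lemma iter_rvolterraE m h x : integrable1 h -> unit_itv x ->
  iter m.+1 rvolterra h x = I (fun t => volterra_kernel m x t * h t).
Proof.
move=> ih; elim: m x => [|m IHm] x Ux; first exact: rvolterraE.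
have k1 s t : unit_itv s -> unit_itv t -> `|volterra_kernel m s t| <= 1 :> R.
  exact: volterra_kernel_le1.
have [ik _] := Fubini_unit_itv (measurable_kernel_pair m) k1 ih.
(* The inner iterate is integrable because it agrees on the interval with the partial integral given
   by Fubini. *)
rewrite iterS rvolterraE//; last first.
  apply: eq_integrable1 ik => s /set_mem Us; by rewrite IHm.
pose k s t : R := volterra_kernel 0 x s * volterra_kernel m s t.
have mk : measurable_fun setT (fun z : R * R => k z.1 z.2).
  apply: measurable_funM; last exact: measurable_kernel_pair.
  exact: measurable_volterra_kernel.
have kb s t : unit_itv s -> unit_itv t -> `|k s t| <= 1.
  by move=> Us Ut; rewrite normrM mulr_ile1// volterra_kernel_le1.
have [_ kE] := Fubini_unit_itv mk kb ih.
transitivity (I (fun s => I (fun t => k s t * h t))).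
  apply: eq_Rintegral => s /set_mem Us; rewrite IHm//.
  rewrite -RintegralZ1; last exact: integrable1_kernelM_r.
  by apply: eq_Rintegral => t _; rewrite /k mulrA.
rewrite kE; apply: eq_Rintegral => t /set_mem Ut.
by rewrite Rintegral_volterra_kernelM.
Qed.

(* The kernel of V^*n is the transpose of that of V^n; peeling off the innermost
   rather than the outermost factor turns the composition of the two kernels
   into the one already computed for V^n. *)
Lemma iter_rvolterra_adjE m h x : integrable1 h -> unit_itv x ->
  iter m.+1 rvolterra_adj h x = I (fun t => volterra_kernel m t x * h t).
Proof.
elim: m h => [|m IHm] h ih Ux; first exact: rvolterra_adjE.
have k1 s t : unit_itv s -> unit_itv t -> `|volterra_kernel 0 t s| <= 1 :> R.
  by move=> Us Ut; exact: volterra_kernel_le1.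
have [ik _] := Fubini_unit_itv (measurable_kernel_pair_swap 0) k1 ih.
rewrite iterSr IHm//; last first.
  by apply: eq_integrable1 ik => s /set_mem Us; rewrite rvolterra_adjE.
pose k s t : R := volterra_kernel 0 t s * volterra_kernel m s x.
have mk : measurable_fun setT (fun z : R * R => k z.1 z.2).
  apply: measurable_funM; first exact: measurable_kernel_pair_swap.
  exact: measurable_volterra_kernel.
have kb s t : unit_itv s -> unit_itv t -> `|k s t| <= 1.
  by move=> Us Ut; rewrite normrM mulr_ile1// volterra_kernel_le1.
have [_ kE] := Fubini_unit_itv mk kb ih.
transitivity (I (fun s => I (fun t => k s t * h t))).
  apply: eq_Rintegral => s /set_mem Us; rewrite rvolterra_adjE//.
  rewrite -RintegralZ1; last exact: integrable1_kernelM_l.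
  apply: eq_Rintegral => t _.
  by rewrite /k mulrA [in RHS](mulrC (volterra_kernel 0 _ _)).
rewrite kE; apply: eq_Rintegral => t /set_mem Ut.
by rewrite Rintegral_volterra_kernelM.
Qed.

(* For s = 1 this is the kernel of Re V^(m+1), and for s = -1 that of
   i Im V^(m+1). *)
Definition signed_kernel (s : R) (m : nat) (x t : R) : R :=
  2^-1 * (volterra_kernel m x t + s * volterra_kernel m t x).

(** * Sections of the signed kernel *)

Lemma square_integrable_kernel_r m x : unit_itv x ->
  square_integrable (fun t => volterra_kernel m x t).
Proof.
move=> Ux; split; first exact: measurable_volterra_kernel_r.
apply: (integrable1_bounded (h' := cst 1)).
- by apply: measurable_funX; exact: measurable_volterra_kernel_r.
- by move=> t Ut; rewrite normrX exprn_ile1// volterra_kernel_le1.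
- exact/square_integrable_integrable/square_integrable_cst.
Qed.

Lemma square_integrable_kernel_l m x : unit_itv x ->
  square_integrable (fun t => volterra_kernel m t x).
Proof.
move=> Ux; split; first exact: measurable_volterra_kernel_l.
apply: (integrable1_bounded (h' := cst 1)).
- by apply: measurable_funX; exact: measurable_volterra_kernel_l.
- by move=> t Ut; rewrite normrX exprn_ile1// volterra_kernel_le1.
- exact/square_integrable_integrable/square_integrable_cst.
Qed.

Lemma square_integrable_signed_kernel s m x : unit_itv x ->
  square_integrable (signed_kernel s m x).
Proof.
move=> Ux; rewrite (_ : signed_kernel s m x = fun t =>
  2^-1 * (volterra_kernel m x t - (- s) * volterra_kernel m t x)).
  apply: square_integrableZ; apply: square_integrableB.
    exact: square_integrable_kernel_r.
  exact/square_integrableZ/square_integrable_kernel_l.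
by apply/funext => t; rewrite /signed_kernel mulNr opprK.
Qed.

Lemma Rintegral_signed_kernelM s m x h : unit_itv x -> integrable1 h ->
  I (fun t => signed_kernel s m x t * h t) =
  2^-1 * (I (fun t => volterra_kernel m x t * h t)
          + s * I (fun t => volterra_kernel m t x * h t)).
Proof.
move=> Ux ih.
have ir := integrable1_kernelM_r m Ux ih.
have il := integrable1_kernelM_l m Ux ih.
rewrite -RintegralZ1// -RintegralD1//; last exact: integrable1Z.
rewrite -RintegralZ1; last by apply: integrable1D => //; exact: integrable1Z.
by apply: eq_Rintegral => t _; rewrite /signed_kernel; ring.
Qed.

(** Squaring doubles the exponent, so only the factorials must be corrected; integrals of squares
    thereby reduce to the integrals of kernels already computed. *)
Lemma volterra_kernel_sqr m x t : volterra_kernel m x t ^+ 2 =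
  (m.*2`!%:R / m`!%:R ^+ 2) * volterra_kernel m.*2 x t.
Proof.
rewrite /volterra_kernel; case: ifP => _; last by rewrite expr0n mulr0.
rewrite -muln2 exprM expr_div_n.
have : (m * 2)`!%:R != 0 :> R by rewrite pnatr_eq0 -lt0n fact_gt0.
have : m`!%:R != 0 :> R by rewrite pnatr_eq0 -lt0n fact_gt0.
by move=> ? ?; field; apply/andP.
Qed.

(** Disjoint supports, the diagonal included. This removes the cross term, the only one in which the
    sign [s] would survive. *)
Lemma volterra_kernel_cross m x t :
  volterra_kernel m x t * volterra_kernel m t x = 0.
Proof.
rewrite /volterra_kernel; case: (ltgtP t x) => _;
  by rewrite ?mulr0 ?mul0r.
Qed.

Lemma Rintegral_signed_kernel_sqr s m x : s ^+ 2 = 1 -> unit_itv x ->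
  I (fun t => signed_kernel s m x t ^+ 2) =
  4^-1 * (m.*2`!%:R / m`!%:R ^+ 2) *
    (x ^+ m.*2.+1 / m.*2.+1`!%:R + (1 - x) ^+ m.*2.+1 / m.*2.+1`!%:R).
Proof.
move=> s1 Ux.
rewrite -Rintegral_volterra_kernel_r// -Rintegral_volterra_kernel_l//.
have ir := square_integrable_integrable (square_integrable_kernel_r m.*2 Ux).
have il := square_integrable_integrable (square_integrable_kernel_l m.*2 Ux).
rewrite -RintegralD1// -RintegralZ1; last exact: integrable1D.
apply: eq_Rintegral => t _.
rewrite -mulrA mulrDr -!volterra_kernel_sqr /signed_kernel.
rewrite exprMn sqrrD exprMn s1 mul1r mulrCA volterra_kernel_cross.
rewrite mulr0 mul0rn addr0.
by congr (_ * _); field.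
Qed.

(** * Coefficients of the kernel sections and the Hilbert-Schmidt norm *)

Lemma normc_L2inner_signed_kernel s m f x : L2 f -> unit_itv x ->
  normc (L2inner (fun t => Complex (signed_kernel s m x t) 0) f) =
  2^-1 * normc (iter m.+1 volterra f x
                + Complex s 0 * iter m.+1 volterra_adj f x).
Proof.
move=> Lf Ux; have [fR fI] := (L2P f).1 Lf.
have iR := square_integrable_integrable fR.
have iI := square_integrable_integrable fI.
have sK := square_integrable_signed_kernel s m Ux.
have LK : L2 (fun t => Complex (signed_kernel s m x t) 0).
  by apply/L2P; split=> //; exact: square_integrable_cst.
have i0 h : I (fun t => 0 * h t) = 0.
  by rewrite (@eq_Rintegral _ _ _ _ _ (cst 0)) ?/Rintegral ?integral0//
    => t _; rewrite mul0r.
rewrite iter_volterraE iter_volterra_adjE.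
rewrite !iter_rvolterraE// !iter_rvolterra_adjE//.
(* The kernel is real and the inner product conjugates [f], so the result is the conjugate of the
   operator's value; only the moduli coincide. *)
rewrite L2innerE//= !i0 addr0 sub0r !Rintegral_signed_kernelM//.
set a := Rintegral _ _ _; set b := Rintegral _ _ _.
set c := Rintegral _ _ _; set d := Rintegral _ _ _.
have -> (y : R) : 2^-1 * Num.sqrt y = Num.sqrt (2^-1 ^+ 2 * y).
  by rewrite sqrtrM ?sqr_ge0// sqrtr_sqr ger0_norm.
by congr Num.sqrt; ring.
Qed.

(** Measurability in [x] is what the exchange of sum and integral requires; it comes from the
    integrability clause of Fubini. *)
Lemma measurable_L2inner_signed_kernel s m f : L2 f -> measurable_fun unit_itv
  (fun x =>
    normc (L2inner (fun t => Complex (signed_kernel s m x t) 0) f) ^+ 2).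
Proof.
move=> Lf; have [fR fI] := (L2P f).1 Lf.
have iR := square_integrable_integrable fR.
have iI := square_integrable_integrable fI.
have mK h : integrable1 h ->
    measurable_fun unit_itv
      (fun x => iter m.+1 rvolterra h x + s * iter m.+1 rvolterra_adj h x).
  move=> ih.
  have k1 x t : unit_itv x -> unit_itv t -> `|volterra_kernel m x t| <= 1 :> R.
    exact: volterra_kernel_le1.
  have [ir _] := Fubini_unit_itv (measurable_kernel_pair m) k1 ih.
  have [il _] := Fubini_unit_itv (measurable_kernel_pair_swap m)
    (fun x t Ux Ut => k1 t x Ut Ux) ih.
  have {ir il} := integrable1D ir (integrable1Z s il).
  move=> /integrableP[/measurable_EFinP + _].
  apply: eq_measurable_fun => x /set_mem Ux.
  by rewrite iter_rvolterraE// iter_rvolterra_adjE.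
pose F x := 2^-1 ^+ 2 * (
  (iter m.+1 rvolterra (fun t => complex.Re (f t)) x +
   s * iter m.+1 rvolterra_adj (fun t => complex.Re (f t)) x) ^+ 2 +
  (iter m.+1 rvolterra (fun t => complex.Im (f t)) x +
   s * iter m.+1 rvolterra_adj (fun t => complex.Im (f t)) x) ^+ 2).
have : measurable_fun unit_itv F.
  apply: measurable_funM => //.
  by apply: measurable_funD; apply: measurable_funX; exact: mK.
apply: eq_measurable_fun => x /set_mem Ux.
rewrite normc_L2inner_signed_kernel// exprMn normc_sqr.
rewrite iter_volterraE iter_volterra_adjE /F /=.
by congr (_ * _); ring.
Qed.

Lemma HSnorm_signed_kernel (e : nat -> R -> R[i]) T s m :
    orthonormal_basis e -> s ^+ 2 = 1 ->
    (forall f x, L2 f -> unit_itv x ->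
       normc (T f x) = 2^-1 * normc (iter m.+1 volterra f x
                        + Complex s 0 * iter m.+1 volterra_adj f x)) ->
  HSnorm e T = (Num.sqrt (4^-1 * (m.*2`!%:R / m`!%:R ^+ 2) *
     (2 / m.*2.+2`!%:R)))%:E.
Proof.
move=> be s1 TE; have [Le _ _] := be.
have U0 : @unit_itv R 0 by apply/unit_itvE; rewrite lexx ler01.
have U1 : @unit_itv R 1 by apply/unit_itvE; rewrite lexx ler01.
pose K x t : R[i] := Complex (signed_kernel s m x t) 0.
have LK x : unit_itv x -> L2 (K x).
  move=> Ux; apply/L2P; split; first exact: square_integrable_signed_kernel.
  exact: square_integrable_cst.
rewrite /HSnorm.
under eq_eseriesr => k _.
  rewrite L2norm_sqr; under eq_integral => x Ux.
    rewrite TE//; last exact: set_mem.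
    rewrite -normc_L2inner_signed_kernel//; last exact: set_mem.
    over.
  over.
(* Nonnegative terms: sum and integral commute without any convergence assumption. *)
rewrite -integral_nneseries//; last 2 first.
- by move=> k; apply/measurable_EFinP; exact: measurable_L2inner_signed_kernel.
- by move=> k x _; rewrite lee_fin sqr_ge0.
pose c : R := 4^-1 * (m.*2`!%:R / m`!%:R ^+ 2).
(* The inner integrals are themselves kernels of index 2m+1, from 0 to [x] and from [x] to 1, so the
   outer integral again reduces to the two one-variable formulas. *)
pose P x : R := volterra_kernel m.*2.+1 x 0 + volterra_kernel m.*2.+1 1 x.
have PE x : unit_itv x ->
    x ^+ m.*2.+1 / m.*2.+1`!%:R + (1 - x) ^+ m.*2.+1 / m.*2.+1`!%:R = P x.
  move=> /unit_itvE/andP[x0 x1].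
  rewrite /P /volterra_kernel subr0; congr (_ + _).
    (* At the endpoint the strict kernel is 0, and so is the power, its exponent being positive. *)
    by case: ltgtP x0 => // <- _; rewrite expr0n mul0r.
  by case: ltgtP x1 => // -> _; rewrite subrr expr0n mul0r.
have Pr := square_integrable_integrable (square_integrable_kernel_r m.*2.+1 U1).
have Pl := square_integrable_integrable (square_integrable_kernel_l m.*2.+1 U0).
have iP : integrable1 P by exact: integrable1D.
under eq_integral => x /set_mem Ux.
  rewrite (L2_parseval be (LK x Ux)) /L2sqr.
  under eq_Rintegral do rewrite normc_sqr /= expr0n addr0.
  rewrite Rintegral_signed_kernel_sqr// PE//.
  over.
have iF : (\int[mu]_(x in unit_itv) (c * P x)%:E)%E = (I (fun x => c * P x))%:E.
  rewrite fineK//; apply: (@integrable_fin_num _ _ R mu _ measurable_unit_itv).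
  exact: integrable1Z.
rewrite iF RintegralZ1// RintegralD1// Rintegral_volterra_kernel_l//.
rewrite Rintegral_volterra_kernel_r// subr0 !expr1n -mulrDl -/c.
by [].
Qed.

End L2_unit_interval_theory.

Theorem theorem3p1 (R : realType) (e : nat -> R -> R[i])
    (he : orthonormal_basis e) (n : nat) (hn : (1 <= n)%N) :
  HSnorm e (Re_volterra n) = HSnorm e (Im_volterra n) /\
  HSnorm e (Im_volterra n) =
    (1 / (Num.sqrt 2 * (n.-1)`!%:R)
      * (1 / Num.sqrt (2 * n%:R * (2 * n%:R - 1))))%:E.
Proof.
case: n hn => [|m _]; first by rewrite ltnn.
have n2 : normc (2 : R[i]) = 2.
  have -> : (2 : R[i]) = Complex (2 : R) 0.
    by apply/eqP; rewrite eq_complex /= addr0 !eqxx.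
  by rewrite /= expr0n addr0 sqrtr_sqr ger0_norm.
have ReE := @HSnorm_signed_kernel R e (Re_volterra m.+1) 1 m he (expr1n _ 2).
have ImE := @HSnorm_signed_kernel R e (Im_volterra m.+1) (-1) m he
  (etrans (sqrrN 1) (expr1n _ 2)).
rewrite ReE; last first.
  move=> f x _ _; rewrite /Re_volterra normcM normcV n2 mulrC.
  by rewrite (_ : Complex 1 0 = 1) ?mul1r.
rewrite ImE; last first.
  (* The divisor 2i has modulus 2, the same as for the real part. *)
  move=> f x _ _; rewrite /Im_volterra normcM normcV normcM n2.
  rewrite (_ : normc 'i%C = 1) ?mulr1; last first.
    by rewrite /= expr0n add0r expr1n sqrtr1.
  rewrite mulrC (_ : Complex (-1) 0 = -1) ?mulN1r//.
  by apply/eqP; rewrite eq_complex /= oppr0 !eqxx.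
split; first by [].
congr EFin.
set q : R := 2 * m.+1%:R * (2 * m.+1%:R - 1).
have q0 : 0 < q.
  have : 1 <= m.+1%:R :> R by rewrite ler1n.
  rewrite /q; nra.
have f0 k : 0 < k`!%:R :> R by rewrite ltr0n fact_gt0.
(* The right side is nonnegative, hence the root of its square, and it suffices to compare
   radicands. *)
rewrite -[RHS]ger0_norm -?sqrtr_sqr; last first.
  by rewrite mulr_ge0// divr_ge0// ?mulr_ge0// ?sqrtr_ge0// ltW.
congr Num.sqrt; rewrite !div1r exprMn !exprVn exprMn.
rewrite !sqr_sqrtr//; last exact: ltW.
rewrite !factS !natrM /q.
(* The two top factors of (2m+2)! become 2n - 1 and 2n; the remaining (2m)! cancels. *)
have -> : m.*2.+1%:R = 2 * m.+1%:R - 1 :> R.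
  by rewrite -addn1 -muln2 natrD natrM -[m.+1]addn1 natrD; ring.
have -> : m.*2.+2%:R = 2 * m.+1%:R :> R.
  by rewrite -doubleS -muln2 natrM mulrC.
move: q0; rewrite /q => q0.
have /andP[qa qb] : (m.+1%:R != 0 :> R) && (2 * m.+1%:R - 1 != 0 :> R).
  rewrite -negb_or -mulf_eq0; apply: contraTN q0 => /eqP q0.
  by rewrite -mulrA q0 mulr0 ltxx.
have := lt0r_neq0 (f0 m); have := lt0r_neq0 (f0 m.*2) => ? ?.
by rewrite !succnK; field; rewrite -mulrS qa qb /=; apply/andP.
Qed.
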